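(* Let $J\in \mathrm{GL}_N(\mathbb{C})$ be a constant matrix, and let $H\in\mathbb{C}^{N\times N}$ belong to the Lie algebra $o_N(\mathbb{C},J)=\{\Omega\in\mathbb{C}^{N\times N} : \Omega^*J+J\Omega=0\}$. Consider the linear equation $x'=Hx$, $x(0)=x_0\in\mathbb{C}^N$. A splitting method of order $p$ which is used as a D-splitting method in the duplicated space to solve this equation is a pseudo-Lie group integrator which preserves the Lie group structure of $\mathrm{O}_N(\mathbb{C},J)=\{X\in\mathrm{GL}_N(\mathbb{C}) : X^*JX=J\}$ up to order $2p+1$. That is, if $M_h\in\mathbb{C}^{N\times N}$ denotes the resulting one-step matrix for time step $h$, so that $x_{n+1}=M_hx_n$, then $$M_h^*\,J\,M_h = J+\mathcal{O}(h^{2p+2})\qquad\text{as } h\to 0 .$$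
   Context: Here $X^*$ denotes the conjugate transpose of $X$, and $\mathrm{GL}_N(\mathbb{C})$ is the group of all non-singular complex $N\times N$ matrices. The fundamental matrix $\mathrm{e}^{tH}$ of $x'=Hx$ lies in the Lie group $\mathrm{O}_N(\mathbb{C},J)$ for all real $t$ when $H\in o_N(\mathbb{C},J)$. **Splitting method of order $p$.** An $s$-stage splitting method is given by numerical coefficients $a_1,\dots,a_s,b_1,\dots,b_s$ (some of which may be zero). It has order $p$ if, for non-commuting indeterminates $X,Y$ and as formal power series in $h$, $$\mathrm{e}^{hb_sY}\,\mathrm{e}^{ha_sX}\cdots \mathrm{e}^{hb_1Y}\,\mathrm{e}^{ha_1X}=\exp\big(h(X+Y)+\mathcal{O}(h^{p+1})\big).$$ **D-splitting method.** To solve $x'=f(x)$, one considers the duplicated system $u'=f(v)$, $v'=f(u)$ with $u(t_0)=v(t_0)=x_0$, whose solution is $u(t)=v(t)=x(t)$, splits it into the two parts $(u',v')=(0,f(u))$ and $(u',v')=(f(v),0)$, and applies the splitting method with these two flows. One step of size $h$ from $x_n$ is: set $u_0=v_0=x_n$, and for $i=1,\dots,s$ $$v_i=v_{i-1}+h a_i f(u_{i-1}),\qquad u_i=u_{i-1}+h b_i f(v_i),$$ and finally $x_{n+1}=\tfrac12(u_s+v_s)$. For $f(x)=Hx$ the map $x_n\mapsto x_{n+1}$ is linear, and $M_h$ denotes its matrix (a polynomial in $hH$). **Pseudo-Lie group integrator.** A one-step method $x_{n+1}=M_hx_n$ for $x'=Hx$ with $H\in o_N(\mathbb{C},J)$ is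 said to preserve the Lie group structure up to order $q$ if $M_h^*JM_h=J+\mathcal{O}(h^{q+1})$ as $h\to0$. It is called a pseudo-Lie group integrator when it preserves the structure in this approximate sense, up to an order higher than the order of the method. *)

(* Defs.v *)
(* The complex numbers are R[i] over R : realType; step sizes and splitting
   coefficients are real. *)
From HB Require Import structures.
From mathcomp Require Import all_boot all_order all_algebra.
From mathcomp Require Import complex.
From mathcomp Require Import all_classical all_reals all_analysis.
(* The notations of monalg clash with those of mathcomp-analysis. *)
From mathcomp.multinomials Require Import -(notations) monalg.

Set Implicit Arguments.
Unset Strict Implicit.
Unset Printing Implicit Defensive.

Import Order.TTheory GRing.Theory Num.Theory.
Import numFieldNormedType.Exports.

Local Open Scope ring_scope.
Local Open Scope complex_scope.
Local Open Scope classical_set_scope.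
Local Open Scope sesquilinear_scope.

(* A formal power series in h over a (non-commutative) algebra A is the
   sequence of its coefficients: z n is the coefficient of h^n. *)
Section FormalPowerSeries.
Variables (R : fieldType) (A : lalgType R).
Implicit Types z w : nat -> A.

Definition fps_one : nat -> A := fun n => (n == 0)%:R.

Definition fps_mul z w : nat -> A := fun n => \sum_(i < n.+1) z i * w (n - i)%N.

Definition fps_linear (x : A) : nat -> A := fun n => if n == 1 then x else 0.

(* Meaningful when z 0 = 0: then z^k has no terms of degree < k, so that
   truncating the exponential series at k = n loses nothing in degree n. *)
Definition fps_exp z : nat -> A := fun n =>
  \sum_(k < n.+1) (k`!%:R)^-1 *: iter k (fps_mul z) fps_one n.

(* z = w + O(h^q) *)
Definition fps_eq_upto (q : nat) z w : Prop := forall n, (n < q)%N -> z n = w n.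

End FormalPowerSeries.

Section SplittingMethod.
Variable R : realType.

(* R<X, Y>: the algebra of the free monoid on two letters. *)
Definition freeXY : lalgType R := malg (fmonom bool) R.
Definition varX : freeXY := mkmalgU (fmu false) 1.
Definition varY : freeXY := mkmalgU (fmu true) 1.

(* Coefficient sequences are indexed from 0: a`_i stands for a_(i+1). *)
Fixpoint splitting_series (a b : seq R) (s : nat) : nat -> freeXY :=
  if s is i.+1 then
    fps_mul (fps_mul (fps_exp (fps_linear (b`_i *: varY)))
                     (fps_exp (fps_linear (a`_i *: varX))))
            (splitting_series a b i)
  else fps_one freeXY.

(* "Order p" means at least p, as usual. *)
Definition splitting_order (p s : nat) (a b : s.-tuple R) : Prop :=
  exists2 z : nat -> freeXY,
    fps_eq_upto p.+1 z (fps_linear (varX + varY)) &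
    splitting_series a b s =1 fps_exp z.

End SplittingMethod.

Section DSplitting.
Variable R : realType.

Section Step.
Variables (V : lmodType R[i]) (f : V -> V) (a b : seq R) (h : R) (x : V).

(* The pair (u_i, v_i). *)
Fixpoint dsplit_stage (i : nat) : V * V :=
  if i is j.+1 then
    let: (u, v) := dsplit_stage j in
    let v' := v + (h * a`_j)%:C *: f u in
    let u' := u + (h * b`_j)%:C *: f v' in
    (u', v')
  else (x, x).

Definition dsplit_step (s : nat) : V :=
  let: (u, v) := dsplit_stage s in 2^-1 *: (u + v).

End Step.

Variable N : nat.

(* M_h, read off column by column; see dsplit_mxP. *)
Definition dsplit_mx (s : nat) (a b : s.-tuple R) (H : 'M[R[i]]_N) (h : R) :
    'M[R[i]]_N :=
  \matrix_(i, j) dsplit_step (fun x : 'cV_N => H *m x) a b h (delta_mx j 0) s i 0.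

Lemma dsplit_mxP (s : nat) (a b : s.-tuple R) (H : 'M[R[i]]_N) (h : R)
    (x : 'cV_N) :
  dsplit_step (fun x : 'cV_N => H *m x) a b h x s = dsplit_mx a b H h *m x.
Proof.
have [P stepE] : exists P : 'M[R[i]]_N, forall y,
    dsplit_step (fun x : 'cV_N => H *m x) a b h y s = P *m y.
  have [U [W UW]] : exists U W : 'M[R[i]]_N, forall y,
      dsplit_stage (fun x : 'cV_N => H *m x) a b h y s = (U *m y, W *m y).
    elim: s {a b}(tval a) (tval b) => [|s IHs] a b.
      by exists 1%:M, 1%:M => y; rewrite !mul1mx.
    have [U [W UW]] := IHs a b.
    pose W' := W + (h * a`_s)%:C *: (H *m U).
    exists (U + (h * b`_s)%:C *: (H *m W')), W' => y /=.
    by rewrite UW !mulmxDl -!scalemxAl -!mulmxA mulmxDl -scalemxAl mulmxA.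
  exists (2^-1 *: (U + W)) => y.
  by rewrite /dsplit_step UW -scalemxAl mulmxDl.
rewrite stepE; congr (_ *m _); apply/matrixP => i j.
by rewrite mxE stepE -colE mxE.
Qed.

(* The Lie algebra o_N(C, J). *)
Definition lie_alg (J : 'M[R[i]]_N) : set 'M[R[i]]_N :=
  [set W | W^t* *m J + J *m W = 0].

(* M_h^* J M_h = J + O(h^(q+1)) as h -> 0, h real *)
Definition preserves_lie_upto (q : nat) (J : 'M[R[i]]_N)
    (M : R -> 'M[R[i]]_N) : Prop :=
  (fun h : R => (M h)^t* *m J *m M h - J)
    =O_ (0^') (fun h : R => (h ^+ q.+1)%:C : R[i]^o).

(* p is the order of the method. *)
Definition pseudo_lie_integrator (p q : nat) (J : 'M[R[i]]_N)
    (M : R -> 'M[R[i]]_N) : Prop :=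
  (p < q)%N /\ preserves_lie_upto q J M.

End DSplitting.

(* Main.v *)
(* In the basis (u, v) one step of the duplicated system is P(hH), where P is a
   2x2 matrix of real polynomials: a product of unipotent triangular matrices,
   so det P = 1, with even diagonal and odd off-diagonal entries. The step
   matrix is m(hH) with m half the sum of the entries of P, and the parities
   together with det P = 1 give
     m(t) m(-t) = 1 + ((P00 - P11)^2 - (P01 - P10)^2) / 4.
   The order condition, evaluated at 2x2 matrix units, forces the coefficients
   of P of degree at most p to commute with the swap of u and v; hence P00 - P11
   and P01 - P10 are O(t^(p+1)), and the defect is O(t^(2p+2)). Finally
   H^* J = - J H turns M_h^* J M_h into J m(-hH) m(hH). *)
Require Import Defs.
From HB Require Import structures.
From mathcomp Require Import all_boot all_order all_algebra.
From mathcomp Require Import ring.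
From mathcomp Require Import complex.
From mathcomp Require Import all_classical all_reals all_analysis.
From mathcomp.multinomials Require Import -(notations) monalg.

Set Implicit Arguments.
Unset Strict Implicit.
Unset Printing Implicit Defensive.

Import Order.TTheory GRing.Theory Num.Theory.
Import numFieldNormedType.Exports.

Local Open Scope ring_scope.
Local Open Scope complex_scope.
Local Open Scope classical_set_scope.
Local Open Scope sesquilinear_scope.

(** * Exponentials of formal power series *)

Section FormalPowerSeriesTheory.
Variables (R : fieldType) (A : algType R).
Implicit Types (x y : A) (z w : nat -> A).

Lemma iter_fps_mul_linear x k n :
  iter k (fps_mul (fps_linear x)) (fps_one A) n = (n == k)%:R * x ^+ k.
Proof.
elim: k n => [|k IHk] n /=; first by rewrite /fps_one mulr1.
rewrite /fps_mul /fps_linear; case: n => [|n].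
  by rewrite big_ord_recl big_ord0 /= !mul0r addr0.
rewrite (bigD1 (lift ord0 ord0)) //= big1 => [|i ne_i1].
  by rewrite addr0 subn1 /= IHk !mulr_natl exprS mulrnAr eqSS.
by rewrite -(inj_eq val_inj) /= in ne_i1; rewrite (negPf ne_i1) mul0r.
Qed.

Lemma fps_exp_linear x n : fps_exp (fps_linear x) n = (n`!%:R)^-1 *: x ^+ n.
Proof.
rewrite /fps_exp big_ord_recr /= iter_fps_mul_linear eqxx mul1r big1 ?add0r //.
by move=> i _; rewrite iter_fps_mul_linear gtn_eqF // mul0r scaler0.
Qed.

(** The coefficient of degree n is a polynomial in z 0, ..., z n, so commutation below degree q is
    inherited. *)
Lemma fps_exp_comm y z q :
  (forall n, (n < q)%N -> GRing.comm y (z n)) ->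
  forall n, (n < q)%N -> GRing.comm y (fps_exp z n).
Proof.
move=> yz n nq; apply: commr_sum => k _.
suff cIk l : (l < q)%N -> GRing.comm y (iter k (fps_mul z) (fps_one A) l).
  by rewrite /GRing.comm -scalerAl -scalerAr cIk.
elim: (nat_of_ord k) l => [|j IHj] l lq /=; first exact: commr_nat.
apply: commr_sum => i _; apply: commrM.
  by apply: yz; apply: leq_trans lq; rewrite ltnS -ltnS.
by apply: IHj; apply: leq_ltn_trans lq; apply: leq_subr.
Qed.

End FormalPowerSeriesTheory.

(** * Images of power series under algebra morphisms *)

Section FormalPowerSeriesMorphism.
Variables (R : fieldType) (A B : lalgType R) (phi : {lrmorphism A -> B}).

Lemma map_fps_one : phi \o fps_one A = fps_one B.
Proof. by apply/funext => n /=; rewrite rmorph_nat. Qed.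

Lemma map_fps_mul (z w : nat -> A) :
  phi \o fps_mul z w = fps_mul (phi \o z) (phi \o w).
Proof.
by apply/funext => n /=; rewrite rmorph_sum; under eq_bigr do rewrite rmorphM.
Qed.

Lemma map_fps_linear x : phi \o fps_linear x = fps_linear (phi x).
Proof.
by apply/funext => n /=; rewrite /fps_linear; case: eqP; rewrite ?rmorph0.
Qed.

Lemma map_fps_exp (z : nat -> A) : phi \o fps_exp z = fps_exp (phi \o z).
Proof.
have iterE k : phi \o iter k (fps_mul z) (fps_one A) =
               iter k (fps_mul (phi \o z)) (fps_one B).
  by elim: k => [|k IHk] /=; rewrite ?map_fps_one // map_fps_mul IHk.
apply/funext => n /=; rewrite raddf_sum; apply: eq_bigr => k _.
by rewrite [LHS]linearZZ -iterE.
Qed.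

End FormalPowerSeriesMorphism.

(** * Evaluation of the free algebra at two matrices *)

Section FreeAlgebraEvaluation.
Variables (R : realType) (n : nat) (E : bool -> 'M[R]_n.+1).

Definition eval_word (w : fmonom bool) : 'M[R]_n.+1 :=
  \prod_(i <- w : seq bool) E i.

Lemma eval_word_mmorphism : mmorphism eval_word.
Proof.
split=> [w1 w2|]; rewrite /eval_word.
  by rewrite fmM big_cat.
by rewrite fm1 big_nil.
Qed.

HB.instance Definition _ :=
  isMultiplicative.Build (fmonom bool) 'M[R]_n.+1 eval_word eval_word_mmorphism.

Definition eval_freeXY : freeXY R -> 'M[R]_n.+1 := mmap scalar_mx eval_word.

(** Coefficients are sent to scalar matrices, which are central; this is the commutation that [mmap]
    needs in order to respect products. *)
Lemma eval_freeXY_multiplicative : multiplicative eval_freeXY.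
Proof.
apply: commr_mmap_is_multiplicative => g m m'.
by apply/esym; exact: scalar_mxC.
Qed.

Lemma eval_freeXY_additive : additive eval_freeXY.
Proof. exact: mmap_is_additive. Qed.

Lemma eval_freeXY_scalable : scalable eval_freeXY.
Proof. by move=> c g; rewrite /eval_freeXY mmapZ /= -mul_scalar_mx. Qed.

HB.instance Definition _ := GRing.isAdditive.Build (freeXY R) 'M[R]_n.+1
  eval_freeXY eval_freeXY_additive.
HB.instance Definition _ := GRing.isMultiplicative.Build (freeXY R) 'M[R]_n.+1
  eval_freeXY eval_freeXY_multiplicative.
HB.instance Definition _ := GRing.isScalable.Build R (freeXY R) 'M[R]_n.+1 *:%R
  eval_freeXY eval_freeXY_scalable.

Lemma eval_varX : eval_freeXY (varX R) = E false.
Proof. by rewrite /eval_freeXY mmapU mul1r /= /eval_word fmU big_seq1. Qed.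

Lemma eval_varY : eval_freeXY (varY R) = E true.
Proof. by rewrite /eval_freeXY mmapU mul1r /= /eval_word fmU big_seq1. Qed.

End FreeAlgebraEvaluation.

(** * The duplicated system as a 2x2 matrix of polynomials *)

Section DSplittingPolynomials.
Variable R : realType.
Implicit Types (P Q : 'M[{poly R}]_2) (E : 'M[R]_2) (a b : seq R).

Lemma big_ord2 (V : nmodType) (F : 'I_2 -> V) : \sum_i F i = F 0 + F 1.
Proof. by rewrite big_ord_recl big_ord1; congr (_ + F _); apply: val_inj. Qed.

(** When E squares to zero this is exp(c t E), the flow of one part of the splitting. *)
Definition shear (c : R) E : 'M[{poly R}]_2 := 1 + (c *: 'X) *: map_mx polyC E.

(* The propagator of the duplicated system in the basis (u, v), with 'X
   standing for hH. *)
Fixpoint dsplit_polymx a b (s : nat) : 'M[{poly R}]_2 :=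
  if s is i.+1 then
    shear b`_i (delta_mx 0 1) * shear a`_i (delta_mx 1 0) * dsplit_polymx a b i
  else 1.

Definition coefmx P (n : nat) : 'M[R]_2 := map_mx (fun p : {poly R} => p`_n) P.

Lemma coefmx1 : coefmx 1 = fps_one 'M[R]_2.
Proof.
apply/funext => n; apply/matrixP => i j.
by rewrite /fps_one mulmxnE !mxE coefMn coef1; case: (i == j); case: n.
Qed.

Lemma coefmxM P Q : coefmx (P * Q) = fps_mul (coefmx P) (coefmx Q).
Proof.
apply/funext => n; apply/matrixP => i j.
rewrite /fps_mul summxE !mxE coef_sum; under eq_bigr do rewrite coefM.
rewrite exchange_big /=; apply: eq_bigr => k _.
by rewrite mxE; apply: eq_bigr => l _; rewrite !mxE.
Qed.

Lemma coefmx_shear c E :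
  E * E = 0 -> coefmx (shear c E) = fps_exp (fps_linear (c *: E)).
Proof.
move=> EE; apply/funext => n; rewrite fps_exp_linear.
apply/matrixP => i j; rewrite [LHS]mxE 3!mxE coefD coefMn coef1 mxE.
rewrite coefMC coefZ coefX.
case: n => [|[|n]] /=.
- by rewrite mulr0 mul0r addr0 expr0 invr1 scale1r !mxE.
- by rewrite mul0rn add0r mulr1 expr1 invr1 scale1r mxE.
(* Nilpotency kills the exponential series from degree 2 on. *)
have cEcE : (c *: E) * (c *: E) = 0 by rewrite -scalerAl -scalerAr EE !scaler0.
by rewrite 2!exprS mulrA cEcE mul0r scaler0 mulr0 mul0r mul0rn addr0 mxE.
Qed.

(** X updates v from u and Y updates u from v, with u in row 0 and v in row 1. The sum of the two
    units is the swap of u and v. *)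
Definition unit_XY (y : bool) : 'M[R]_2 :=
  if y then delta_mx 0 1 else delta_mx 1 0.

Lemma unit_XY_sqr y : unit_XY y * unit_XY y = 0.
Proof. by case: y; rewrite /unit_XY /= -[LHS]/(_ *m _) mul_delta_mx_0. Qed.

Lemma coefmx_dsplit_polymx a b s :
  coefmx (dsplit_polymx a b s) = eval_freeXY unit_XY \o splitting_series a b s.
Proof.
elim: s => [|s IHs] /=; first by rewrite coefmx1 map_fps_one.
have shearE y c v : eval_freeXY unit_XY v = unit_XY y ->
    coefmx (shear c (unit_XY y)) =
    eval_freeXY unit_XY \o fps_exp (fps_linear (c *: v)).
  move=> vE; rewrite map_fps_exp map_fps_linear /= eval_freeXY_scalable vE.
  by rewrite coefmx_shear ?unit_XY_sqr.
rewrite 2!map_fps_mul -IHs 2!coefmxM.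
congr (fps_mul (fps_mul _ _) _).
  by rewrite -(shearE true) ?eval_varY.
by rewrite -(shearE false) ?eval_varX.
Qed.

(** Up to degree p the exponent has no term other than h(X + Y), which commutes with X + Y;
    evaluation carries this over to the propagator. *)
Lemma dsplit_polymx_comm p s (a b : s.-tuple R) n :
  splitting_order p a b -> (n <= p)%N ->
  GRing.comm (unit_XY false + unit_XY true) (coefmx (dsplit_polymx a b s) n).
Proof.
case=> z zE sE np; rewrite coefmx_dsplit_polymx /= sE.
have -> : unit_XY false + unit_XY true = eval_freeXY unit_XY (varX R + varY R).
  by rewrite raddfD /= eval_varX eval_varY.
have -> : eval_freeXY unit_XY (fps_exp z n) =
    fps_exp (eval_freeXY unit_XY \o z) n.
  by rewrite -map_fps_exp.
apply: (@fps_exp_comm _ _ _ _ p.+1) => // k kp.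
rewrite /= zE // /fps_linear; case: eqP => // _.
by rewrite raddf0; apply: commr0.
Qed.

Lemma dsplit_polymx_symm p s (a b : s.-tuple R) n
    (P := dsplit_polymx a b s) :
  splitting_order p a b -> (n <= p)%N ->
  (P 0 0)`_n = (P 1 1)`_n /\ (P 0 1)`_n = (P 1 0)`_n.
Proof.
move=> hab np; have /matrixP cP := dsplit_polymx_comm hab np.
(* Entry (0, 1) of the commutation with the swap compares the diagonal entries, entry (0, 0) the
   off-diagonal ones. *)
split; [have := cP 0 1 | have := cP 0 0];
  rewrite !mxE !big_ord2 !mxE /=;
  by rewrite !(mul0r, mul1r, mulr0, mulr1, add0r, addr0) => ->.
Qed.

(** One stage, column by column: v is updated first, and its new value r feeds the update of u. The
    inductions below rest on this recursion. *)
Lemma dsplit_polymxS a b s (P := dsplit_polymx a b s) j :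
  let r := P 1 j + (a`_s *: 'X) * P 0 j in
  dsplit_polymx a b s.+1 1 j = r /\
  dsplit_polymx a b s.+1 0 j = P 0 j + (b`_s *: 'X) * r.
Proof.
rewrite /= -mulrA -/P; split;
  rewrite /shear !mxE !big_ord2 !mxE !big_ord2 !mxE /=;
  by rewrite !(mulr1n,mulr0n,polyC0,polyC1); ring.
Qed.

(** Each update adds a multiple of one row to the other, which leaves the determinant unchanged. *)
Lemma dsplit_polymx_det a b s (P := dsplit_polymx a b s) :
  P 0 0 * P 1 1 - P 0 1 * P 1 0 = 1.
Proof.
elim: s @P => [|s IHs] /=; first by rewrite !mxE /= mulr1 mulr0 subr0.
have [E10 E00] := dsplit_polymxS a b s 0.
have [E11 E01] := dsplit_polymxS a b s 1.
by rewrite -[RHS]IHs E10 E00 E11 E01; ring.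
Qed.

(* (u, v, t) -> (u, -v, -t) is a symmetry of the splitting. *)
Lemma dsplit_polymx_parity a b s i j :
  dsplit_polymx a b s i j \Po - 'X = (-1) ^+ (i != j) * dsplit_polymx a b s i j.
Proof.
have ord2 (k : 'I_2) : k = 0 \/ k = 1.
  by case: k => [[|[]]] // ?; [left|right]; apply: val_inj.
elim: s i j => [|s IHs] i j.
  by rewrite !mxE rmorph_nat; case: eqVneq => _; rewrite ?mul1r ?mulr0.
have [E1 E0] := dsplit_polymxS a b s j; have [I0 I1] := (IHs 0 j, IHs 1 j).
case: (ord2 i) (ord2 j) => -> [] jE; rewrite {}jE /= in I0 I1 E0 E1 *;
  rewrite ?E0 ?E1 !(comp_polyD, comp_polyM, comp_polyZ, comp_polyX) I0 I1;
  rewrite !scalerN; ring.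
Qed.

(** Adding the columns reflects the common start u = v = x; adding the rows and halving is the final
    average. *)
Definition dsplit_poly a b s : {poly R} :=
  2^-1 *: (dsplit_polymx a b s 0 0 + dsplit_polymx a b s 0 1
           + dsplit_polymx a b s 1 0 + dsplit_polymx a b s 1 1).

Lemma dsplit_poly_symplectic_defect a b s
    (P := dsplit_polymx a b s) (m := dsplit_poly a b s) :
  m * (m \Po - 'X) = 1 + 4^-1 *: ((P 0 0 - P 1 1) ^+ 2 - (P 0 1 - P 1 0) ^+ 2).
Proof.
have det1 := dsplit_polymx_det a b s.
rewrite /m /dsplit_poly comp_polyZ !comp_polyD !dsplit_polymx_parity /=.
have n4 : 4 != 0 :> R by rewrite pnatr_eq0.
apply: (scalerI n4); rewrite -scalerAl -scalerAr scalerDr !scalerA.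
rewrite [X in X *: _ = _](_ : _ = 1); last by field.
rewrite divff // !scale1r !expr0 !expr1 -/P.
(* Writing 4 as 4 det P leaves an identity of quadratic forms in the entries of P. *)
have -> : 4%:A = 4 * (P 0 0 * P 1 1 - P 0 1 * P 1 0) :> {poly R}.
  by rewrite det1 mulr1 scaler_nat.
ring.
Qed.

Lemma poly_low_coef0 (q : {poly R}) n :
  (forall k, (k < n)%N -> q`_k = 0) -> q = drop_poly n q * 'X^n.
Proof.
move=> q0; rewrite -[LHS](poly_take_drop n) -[RHS]add0r; congr (_ + _).
by apply/polyP => k; rewrite coef_take_poly coef0; case: ifP => // /q0.
Qed.

Lemma dsplit_poly_order p s (a b : s.-tuple R) :
  splitting_order p a b ->
  exists q, dsplit_poly a b s * (dsplit_poly a b s \Po - 'X)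
            = 1 + q * 'X^((2 * p + 1).+1).
Proof.
move=> hab; rewrite dsplit_poly_symplectic_defect; set P := dsplit_polymx a b s.
(* Squaring doubles the order of vanishing, from p + 1 to 2p + 2. *)
have low (d : {poly R}) : (forall k, (k < p.+1)%N -> d`_k = 0) ->
  d ^+ 2 = drop_poly p.+1 d ^+ 2 * 'X^((2 * p + 1).+1).
  move=> /poly_low_coef0 {1}->; rewrite exprMn -exprM; congr (_ * 'X^ _).
  by rewrite mulnC mulnS addn1.
have -> := low (P 0 0 - P 1 1) => [|k kp]; last first.
  by rewrite coefB (dsplit_polymx_symm hab kp).1 subrr.
have -> := low (P 0 1 - P 1 0) => [|k kp]; last first.
  by rewrite coefB (dsplit_polymx_symm hab kp).2 subrr.
exists (4^-1 *: (drop_poly p.+1 (P 0 0 - P 1 1) ^+ 2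
                 - drop_poly p.+1 (P 0 1 - P 1 0) ^+ 2)).
by rewrite -scalerAl mulrBl.
Qed.

End DSplittingPolynomials.

Section MatrixPolynomials.
Variables (R : realType) (N : nat).
Implicit Types (A B H J : 'M[R[i]]_N.+1) (q : {poly R}) (a b : seq R) (h : R).

(** The polynomials are kept real although A is complex: conjugation then fixes their coefficients
    in the adjoint rule. *)
Definition real_horner_mx A q : 'M[R[i]]_N.+1 :=
  (horner_mx A \o map_poly (real_complex R)) q.

HB.instance Definition _ A := GRing.RMorphism.copy (real_horner_mx A)
  (horner_mx A \o map_poly (real_complex R)).

Lemma real_horner_mxX A : real_horner_mx A 'X = A.
Proof. by rewrite /real_horner_mx /= map_polyX horner_mx_X. Qed.

Lemma real_horner_mxC A c : real_horner_mx A c%:P = (c%:C)%:M.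
Proof. by rewrite /real_horner_mx /= map_polyC horner_mx_C. Qed.

Lemma real_horner_mxZ A c q :
  real_horner_mx A (c *: q) = c%:C *: real_horner_mx A q.
Proof.
by rewrite -mul_polyC rmorphM /= real_horner_mxC -[RHS]mul_scalar_mx.
Qed.

Lemma real_horner_mxM A p q :
  real_horner_mx A (p * q) = real_horner_mx A p *m real_horner_mx A q.
Proof. exact: rmorphM. Qed.

(** Both components start from x, so each is given by a row sum of the propagator evaluated at
    hH. *)
Lemma dsplit_stage_polymx H a b h s (x : 'cV_N.+1)
    (P := dsplit_polymx a b s) (ev := real_horner_mx (h%:C *: H)) :
  dsplit_stage (fun x : 'cV_N.+1 => H *m x) a b h x s =
  (ev (P 0 0 + P 0 1) *m x, ev (P 1 0 + P 1 1) *m x).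
Proof.
elim: s @P => [|s IHs] /=.
  have ev1 : ev 1 = 1%:M by exact: rmorph1.
  by rewrite !mxE /= addr0 add0r !mulr1n ev1 mul1mx.
have [E10 E00] := dsplit_polymxS a b s 0.
have [E11 E01] := dsplit_polymxS a b s 1.
set P := dsplit_polymx a b s in IHs E10 E00 E11 E01.
rewrite -[shear _ _ * _ * _]/(dsplit_polymx a b s.+1) IHs.
have step c p q : ev p *m x + (h * c)%:C *: (H *m (ev q *m x)) =
    ev (p + (c *: 'X) * q) *m x.
  rewrite /ev rmorphD /= real_horner_mxM real_horner_mxZ real_horner_mxX.
  by rewrite mulmxDl scalerA -rmorphM (mulrC c) -!scalemxAl mulmxA.
rewrite !step; congr (ev _ *m x, ev _ *m x).
  by rewrite E00 E01; ring.
by rewrite E10 E11; ring.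
Qed.

Lemma dsplit_mx_poly s (a b : s.-tuple R) H h :
  dsplit_mx a b H h = real_horner_mx (h%:C *: H) (dsplit_poly a b s).
Proof.
have mulE (x : 'cV_N.+1) :
    dsplit_mx a b H h *m x =
    real_horner_mx (h%:C *: H) (dsplit_poly a b s) *m x.
  rewrite -dsplit_mxP /dsplit_step dsplit_stage_polymx -mulmxDl scalemxAl.
  rewrite -rmorphD addrA /dsplit_poly real_horner_mxZ.
  by rewrite fmorphV rmorph_nat.
apply/matrixP => i j.
by have /matrixP/(_ i 0) := mulE (delta_mx j 0); rewrite -!colE !mxE.
Qed.

Lemma trmxCM A B : (A *m B)^t* = B^t* *m A^t*.
Proof. by rewrite trmx_mul map_mxM. Qed.

Lemma conj_real_complex (c : R) : Num.conj (c%:C : R[i]) = c%:C.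
Proof. exact: conjc_real. Qed.

Lemma trmxCD A B : (A + B)^t* = A^t* + B^t*.
Proof. by apply/matrixP => i j; rewrite !mxE rmorphD. Qed.

Lemma trmxCZ (c : R) A : (c%:C *: A)^t* = c%:C *: A^t*.
Proof. by apply/matrixP => i j; rewrite !mxE rmorphM /= conj_real_complex. Qed.

Lemma trmxC_scalar (c : R) : ((c%:C)%:M : 'M[R[i]]_N.+1)^t* = (c%:C)%:M.
Proof.
by apply/matrixP => i j; rewrite !mxE eq_sym rmorphMn /= conj_real_complex.
Qed.

(** Each factor A changes sign when its adjoint is moved across J, while real scalars pass
    unchanged. *)
Lemma real_horner_mx_adj J A q : A^t* *m J = - (J *m A) ->
  (real_horner_mx A q)^t* *m J = J *m real_horner_mx A (q \Po - 'X).
Proof.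
move=> AJ; elim/poly_ind: q => [|q c IHq].
  by rewrite comp_poly0 rmorph0 trmx0 map_mx0 mul0mx mulmx0.
rewrite comp_polyD comp_polyM comp_polyX comp_polyC !rmorphD.
rewrite /= !real_horner_mxM rmorphN /= real_horner_mxX !real_horner_mxC.
rewrite trmxCD trmxC_scalar mulmxDl mulmxDr; congr (_ + _);
  last by rewrite -scalar_mxC.
have AqC : real_horner_mx A (q \Po - 'X) *m A =
    A *m real_horner_mx A (q \Po - 'X).
  by rewrite -{2 3}(real_horner_mxX A) -!real_horner_mxM mulrC.
by rewrite trmxCM -mulmxA IHq [LHS]mulmxA AJ mulNmx -!mulmxA !mulmxN AqC.
Qed.

Lemma lie_alg_scale J H h : lie_alg J H ->
  (h%:C *: H)^t* *m J = - (J *m (h%:C *: H)).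
Proof.
move=> /eqP HJ; rewrite trmxCZ -scalemxAl -scalemxAr -scalerN.
by congr (_ *: _); apply/eqP; rewrite -addr_eq0.
Qed.

(** Horner's scheme: each factor h has modulus at most 1. The left factor B is arbitrary so that the
    induction can absorb one A into it. *)
Lemma real_horner_mx_bounded A B q :
  exists2 C : R[i], 0 <= C & forall h, `|h| <= 1 ->
    `|B *m real_horner_mx (h%:C *: A) q| <= C.
Proof.
elim/poly_ind: q B => [|q c IHq] B.
  by exists 0 => // h _; rewrite rmorph0 mulmx0 normr0.
have [C C0 CP] := IHq (B *m A).
exists (C + `|B *m (c%:C)%:M|); first by rewrite addr_ge0.
move=> h h1; rewrite mulrC rmorphD /= real_horner_mxM real_horner_mxX.
rewrite real_horner_mxC mulmxDr (le_trans (ler_normD _ _)) // lerD2r.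
rewrite -scalemxAl -scalemxAr mulmxA.
rewrite normrZ (le_trans _ (CP h h1)) // ler_piMl // normc_def /=.
by rewrite expr0n addr0 sqrtr_sqr -[1]/(1%:C) lecR.
Qed.

End MatrixPolynomials.

(** * The defect estimate as h tends to 0 *)

Theorem theorem1 (R : realType) (N s p : nat) (J H : 'M[R[i]]_N)
    (a b : s.-tuple R)
    (hJ : J \in unitmx)
    (hH : lie_alg J H)
    (hab : splitting_order p a b) :
  pseudo_lie_integrator p (2 * p + 1) J (dsplit_mx a b H).
Proof.
split; first by rewrite addn1 ltnS leq_pmull.
case: N J H hJ hH => [|N] J H hJ hH.
  (* Size 0 is treated apart, since [real_horner_mx] is set up for positive size; here the defect is
     the empty matrix. *)
  rewrite /preserves_lie_upto; apply/eqO_exP; exists 1 => //.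
  by apply: nearW => h; rewrite [X in `|X|]flatmx0 normr0 mulr_ge0.
have [q mE] := dsplit_poly_order hab.
set k := (2 * p + 1).+1 in mE.
have [C C0 CP] := real_horner_mx_bounded H (J *m H ^+ k) q.
(* The adjoint rule turns the defect into J (m(-hH) m(hH) - 1), from which the factor (hH)^k splits
   off. *)
have defect h : (dsplit_mx a b H h)^t* *m J *m dsplit_mx a b H h - J =
    (h ^+ k)%:C *: ((J *m H ^+ k) *m real_horner_mx (h%:C *: H) q).
  rewrite dsplit_mx_poly (real_horner_mx_adj _ (lie_alg_scale h hH)).
  rewrite -[X in X - _]mulmxA -real_horner_mxM.
  rewrite [X in real_horner_mx _ X]mulrC mE (mulrC q).
  rewrite rmorphD rmorph1 /= real_horner_mxM rmorphXn /= real_horner_mxX.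
  rewrite mulmxDr mulmx1 addrC addKr exprZn -rmorphXn -scalemxAl -scalemxAr.
  by rewrite mulmxA.
(* The bound C may be 0, whereas the constant of a big O has to be positive. *)
apply/eqO_exP; exists (C + 1); first by rewrite ltr_wpDl.
near=> h.
rewrite defect normrZ mulrC ler_wpM2r //.
rewrite (le_trans (CP h _)) ?lerDl //.
by near: h; apply: dnbhs0_le.
Unshelve. all: by end_near. Qed.
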